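(* Let $q$ be a power of an odd prime, write $q-1=2^s r$ with $r$ odd, and let $c\in\mathbb{F}_q^*$. The functional graph of $f(X)=c(X^{q+1}-X^2)$ over $\mathbb{F}_{q^2}$ is isomorphic to $$\mathscr{Z}(q)\ \oplus\ \bigoplus_{d\mid r}\frac{\varphi(d)(q-1)}{2\,\mathrm{ord}_{3d}(4)}\times\big(Cyc(2\,\mathrm{ord}_{3d}(4)),\mathscr{T}(s)\big).$$
   Context: The functional graph of a map $f:\mathbb{F}_{q^2}\to\mathbb{F}_{q^2}$ is the directed graph with vertex set $\mathbb{F}_{q^2}$ and an edge $x\to f(x)$ for every $x$. $Cyc(n)$ is the directed cycle of length $n$. $\mathscr{T}(1)$ is the tree with two vertices $P_1,P$ and the edge $P_1\to P$ (root $P$); for $m\ge1$, $\mathscr{T}(m+1)$ is obtained from $\mathscr{T}(m)$ by attaching two new vertices, each with an edge directed to it, to every vertex of the last (top) level of $\mathscr{T}(m)$. $(Cyc(n),\mathscr{T}(m))$ is the graph obtained from $Cyc(n)$ by replacing each vertex of the cycle by a copy of $\mathscr{T}(m)$ whose root is that cycle vertex. $\mathscr{Z}(q)$ is the graph consisting of a vertex with a loop ($Cyc(1)$) to which $\frac{q-1}{2}$ copies of $\mathscr{T}(1)$ and $\frac{q-1}{2}$ copies of $\mathscr{T}(2)$ are attached, the root of each copy being identified with the fixed vertex. $\oplus$ denotes disjoint union and $k\times G$ denotes $k$ disjoint copies of $G$. $\varphi$ is Euler's totient function and $\mathrm{ord}_m(n)$ is the multiplicative order of $n$ modulo $m$.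 *)

(* Defs.v *)
From mathcomp Require Import all_boot all_algebra.
Set Implicit Arguments. Unset Strict Implicit. Unset Printing Implicit Defensive.

Record fgraph := FGraph { fg_V : finType; fg_succ : fg_V -> fg_V }.
Arguments fg_succ f _ : clear implicits.

Definition fg_iso (G H : fgraph) : Prop :=
  exists h : fg_V G -> fg_V H, bijective h /\
    forall x y : fg_V G, (fg_succ G x == y) = (fg_succ H (h x) == h y).

Definition functional_graph (T : finType) (f : T -> T) : fgraph := @FGraph T f.

Definition fg_sum (G H : fgraph) : fgraph :=
  @FGraph (fg_V G + fg_V H)%type
    (fun x => match x with inl a => inl (fg_succ G a) | inr b => inr (fg_succ H b) end).
Definition fg_copies (k : nat) (G : fgraph) : fgraph :=
  @FGraph ('I_k * fg_V G)%type (fun x => (x.1, fg_succ G x.2)).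
Definition fg_empty : fgraph := @FGraph void (fun x => x).

(* Non-root vertices of the tree T(m): pairs (l, i) with level 1 <= l <= m
   and index i < 2^(l-1) (level l of T(m) has 2^(l-1) vertices).
   The root is represented by None in option (tnode m). *)
Definition tnode (m : nat) : finType :=
  {p : 'I_m.+1 * 'I_(2 ^ m).+1 | (0 < p.1) && (p.2 < 2 ^ (p.1 - 1))}.

Definition tparent (m : nat) (v : tnode m) : option (tnode m) :=
  let p := val v in
  if p.1 == 1 :> nat then None
  else insub ((inord (p.1 - 1), inord (p.2 %/ 2)) : 'I_m.+1 * 'I_(2 ^ m).+1).

Definition cyc_trees (n m : nat) : fgraph :=
  @FGraph ('I_n * option (tnode m))%type
    (fun x => match x.2 with
              | None => (ordS x.1, None)
              | Some v => (x.1, tparent v)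
              end).

(* Z(q): a fixed vertex (None) with (q-1)/2 copies of T(1) and (q-1)/2
   copies of T(2) attached at their roots. *)
Definition Zgraph (q : nat) : fgraph :=
  @FGraph (option ('I_(q.-1./2) * tnode 1 + 'I_(q.-1./2) * tnode 2))%type
    (fun x => match x with
              | None => None
              | Some (inl (i, v)) => omap (fun w => inl (i, w)) (tparent v)
              | Some (inr (i, v)) => omap (fun w => inr (i, w)) (tparent v)
              end).

(* Multiplicative order of a modulo m: the least k >= 1 with a^k = 1 (mod m)
   (searched among 1..m, which suffices when a is a unit mod m, m >= 2). *)
Definition ord_mod (m a : nat) : nat :=
  (find (fun k => a ^ k.+1 == 1 %[mod m]) (iota 0 m)).+1.

Definition target_graph (q s r : nat) : fgraph :=
  fg_sum (Zgraph q)
    (foldr (fun d acc =>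
              fg_sum (fg_copies (totient d * q.-1 %/ (2 * ord_mod (3 * d) 4))
                                (cyc_trees (2 * ord_mod (3 * d) 4) s)) acc)
           fg_empty (divisors r)).

(* Main.v *)
(* Write x' = x ^ q, t = x + x' [tr] and u = x - x' [di]. Then f x = - c u x, and f sends
   (t, u) to (- c u ^ 2, - c t u). Hence y = - c ^ 3 t u ^ 2 [mult], in F_q,
   satisfies y (f x) = y x ^ 2 and f (f x) = y x * x. The points with t u = 0
   form Z(q). On the others, x |-> (y, u) is a bijection onto the pairs with
   y ^ (q - 1) = 1 and u ^ (q - 1) = -1, and the fibres of f are pairs {x, - x},
   on which y changes sign, so the height of x above its cycle is the exponent
   of 2 in the order of y. When y has odd order d, odd iterates of f do not fix
   x, and f ^ (2 m) x = x iff y ^ (1 + 4 + ... + 4 ^ (m - 1)) = 1 iff 3 d divides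
   4 ^ m - 1, so x has period 2 ord_{3d}(4). There are phi(d) (q - 1) such x. *)
Require Import Defs.
From mathcomp Require Import all_boot all_algebra all_solvable all_field ring.
Import GRing.Theory.

(** * Functional graphs *)

(* [W] is isomorphic to the restriction of [F] to [P]; stated with an embedding
   into [T], so that [F] need not be restricted to a subtype. *)
Definition models {T : Type} (F : T -> T) (P : pred T) (W : Defs.fgraph) : Prop :=
  exists h : fg_V W -> T,
    [/\ injective h, forall x, P x <-> exists w, h w = x
      & forall w, h (fg_succ W w) = F (h w)].

Lemma eq_models {T : Type} (F : T -> T) (P Q : pred T) (W : Defs.fgraph) :
  P =1 Q -> models F P W -> models F Q W.
Proof. by move=> PQ [h [? hP ?]]; exists h; split=> // x; rewrite -PQ. Qed.

Lemma models_iso (T : finType) (F : T -> T) (W : Defs.fgraph) :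
  models F xpredT W -> fg_iso (functional_graph F) W.
Proof.
case=> h [h_inj hP hF].
have h_surj y : exists x, h x == y by have [/(_ isT)[x <-] _] := hP y; exists x.
pose g y := xchoose (h_surj y).
have gK : cancel g h by move=> y; apply/eqP/(xchooseP (h_surj y)).
have hK : cancel h g by move=> w; apply: h_inj; rewrite gK.
exists g; split; first by exists h.
by move=> x y /=; rewrite -(inj_eq h_inj) hF !gK.
Qed.

Lemma models_sum {T : Type} (F : T -> T) (P Q : pred T) (V W : Defs.fgraph) :
  (forall x, P x -> ~~ Q x) -> models F P V -> models F Q W ->
  models F (predU P Q) (fg_sum V W).
Proof.
move=> PQ [g [g_inj gP gF]] [h [h_inj hQ hF]].
have Pg v : P (g v) by apply/gP; exists v.
have Qh w : Q (h w) by apply/hQ; exists w.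
exists (fun u : fg_V V + fg_V W => match u with inl v => g v | inr w => h w end).
split=> [[v|w] [v'|w'] /=|x|[v|w] /=]; rewrite ?gF ?hF //.
- by move/g_inj->.
- by move=> e; have := PQ _ (Pg v); rewrite e Qh.
- by move=> e; have := PQ _ (Pg v'); rewrite -e Qh.
- by move/h_inj->.
split=> [/orP[/gP[v]|/hQ[w]]|[[v|w] <-]] /=; rewrite ?Pg ?Qh ?orbT //.
  by exists (inl v).
by exists (inr w).
Qed.

(** A point determines its index and [ds] has no repetition, so the pieces are pairwise disjoint and
    can be added one at a time. The fold has the shape of the one in [target_graph]. *)
Lemma models_foldr_sum {T : Type} {I : eqType} (F : T -> T) (Q : I -> pred T)
    (W : I -> Defs.fgraph) (ds : seq I) :
  uniq ds -> (forall d e x, Q d x -> Q e x -> d = e) ->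
  {in ds, forall d, models F (Q d) (W d)} ->
  models F (fun x => has (Q^~ x) ds)
    (foldr (fun d acc => fg_sum (W d) acc) fg_empty ds).
Proof.
move=> + Qinj; elim: ds => [_ _|d ds IH /= /andP[nd Uds] QW].
  by exists (fun w : void => match w with end); split=> // x; split=> // -[[]].
apply: models_sum; last 2 first.
- by apply: QW; rewrite inE eqxx.
- by apply: IH => // e eds; apply: QW; rewrite inE eds orbT.
move=> x Qdx; apply/hasP=> -[e eds Qex].
by rewrite (Qinj _ _ _ Qdx Qex) eds in nd.
Qed.

(** [F] permutes [C] and all its cycles there have length [n], so there are [#|C| %/ n] of them; the
    canonical root of each cycle gives [rt]. *)
Lemma cycle_transversal (T : finType) (F : T -> T) (C : {pred T}) (n : nat) :
  0 < n -> {homo F : x / x \in C} -> {in C &, injective F} ->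
  {in C, forall x m, (iter m F x == x) = (n %| m)} ->
  exists rt : 'I_(#|C| %/ n) -> T,
    [/\ forall i, rt i \in C,
        {in C, forall x, exists i, exists j : 'I_n, x = iter j F (rt i)}
      & forall i i' (j j' : 'I_n),
          iter j F (rt i) = iter j' F (rt i') -> i = i' /\ j = j'].
Proof.
move=> n_gt0 FC F_inj per.
(* Extending by the identity outside [C] gives a permutation of all of [T], to which orbits, orders
   and roots apply. *)
pose G x := if x \in C then F x else x.
have GC x : (G x \in C) = (x \in C).
  by rewrite /G; case: ifP => // xC; rewrite FC.
have G_inj : injective G.
  move=> x y eG; have exy : (x \in C) = (y \in C) by rewrite -GC eG GC.
  move: eG; rewrite /G exy; case: ifP => // yC; apply: F_inj => //.
  by rewrite exy.
have GF x m : x \in C -> iter m G x = iter m F x /\ iter m F x \in C.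
  move=> xC; elim: m => //= m [-> IH]; rewrite /G IH; split=> //; exact: FC.
have ordn x : x \in C -> order G x = n.
  move=> xC; apply/eqP; rewrite eqn_leq; apply/andP; split; last first.
    apply: dvdn_leq (order_gt0 _ _) _.
    by rewrite -(per x xC) -(GF _ _ xC).1 iter_order.
  (* If the order exceeded [n], the point [iter n G x] would have index [n] on the orbit of [x]; but
     it is [x], of index 0. *)
  rewrite leqNgt; apply/negP=> /findex_iter.
  have /eqP : iter n F x == x by rewrite per.
  by rewrite -(GF _ _ xC).1 => ->; rewrite findex0 => n0; rewrite -n0 in n_gt0.
have clC : fclosed G C by move=> x y /eqP <-; rewrite GC.
have symG := fconnect_sym G_inj.
have cardR : #|predI (roots (frel G)) C| = #|C| %/ n.
  have /(_ _ clC) := @fcard_order_set _ _ G_inj n C.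
  rewrite /n_comp_mem /order_set => <-; last first.
    by apply/subsetP=> x xC; rewrite inE ordn.
  rewrite mulnK //; apply: eq_card => x; by rewrite !inE.
exists (fun i => enum_val (cast_ord (esym cardR) i)).
set R := predI _ _ in cardR *.
have rtR i : enum_val (cast_ord (esym cardR) i) \in R by apply: enum_valP.
have rtC i : enum_val (cast_ord (esym cardR) i) \in C by have /andP[] := rtR i.
split=> // [x xC|i i' j j' e].
  pose y := froot G x; have cyx : fconnect G y x by rewrite symG connect_root.
  have yC : y \in C by rewrite -(closed_connect clC (connect_root _ x)).
  have yR : y \in R by apply/andP; split=> //; apply: roots_root.
  have jn : findex G y x < n by rewrite -(ordn y yC) findex_max.
  exists (cast_ord cardR (enum_rank_in yR y)), (Ordinal jn).
  by rewrite cast_ordK enum_rankK_in //= -(GF _ _ yC).1 iter_findex.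
rewrite -!(GF _ _ (rtC _)).1 in e.
have eii : i = i'.
  apply: (@cast_ord_inj _ _ (esym cardR)); apply: enum_val_inj.
  have /andP[/eqP <- _] := rtR i; have /andP[/eqP <- _] := rtR i'.
  apply/eqP; rewrite (root_connect symG).
  apply: connect_trans (fconnect_iter _ j _) _.
  by rewrite e symG fconnect_iter.
split=> //; apply: val_inj => /=; rewrite -{}eii in e.
by rewrite -(@findex_iter _ G (enum_val (cast_ord (esym cardR) i)) j) ?ordn // e
  findex_iter ?ordn.
Qed.

(** * Trees addressed by level and index, and cycles carrying such trees *)

Definition tlevel {m} (v : tnode m) : nat := (val v).1.
Definition tindex {m} (v : tnode m) : nat := (val v).2.

Lemma tlevelP {m} (v : tnode m) : 0 < tlevel v <= m.
Proof.
case: v => -[l i] H; case/andP: (H) => /= l0 _.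
rewrite /tlevel /= l0 -ltnS; apply: ltn_ord.
Qed.

Lemma tindexP {m} (v : tnode m) : tindex v < 2 ^ (tlevel v).-1.
Proof. by rewrite -subn1; case: v => -[l i] H; case/andP: (H). Qed.

Lemma tnode_inj {m} (u v : tnode m) :
  tlevel u = tlevel v -> tindex u = tindex v -> u = v.
Proof.
case: u v => [[l i] H] [[l' i'] H']; rewrite /tlevel /tindex /= => el ei.
by apply: val_inj => /=; congr pair; apply: val_inj.
Qed.

Lemma tnode_exists {m} l i : 0 < l <= m -> i < 2 ^ l.-1 ->
  exists2 v : tnode m, tlevel v = l & tindex v = i.
Proof.
case/andP=> l0 lm il.
have il' : i < (2 ^ m).+1.
  by rewrite (leq_trans il) // leqW // leq_exp2l // (leq_trans (leq_pred _)).
have lm' : l < m.+1 by [].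
have H : (0 < (Ordinal lm', Ordinal il').1) &&
  ((Ordinal lm', Ordinal il').2 < 2 ^ ((Ordinal lm', Ordinal il').1 - 1)).
  by rewrite /= l0 subn1.
by exists (exist _ (Ordinal lm', Ordinal il') H).
Qed.

Lemma tparent1 {m} (v : tnode m) : tlevel v = 1 -> tparent v = None.
Proof. by rewrite /tparent /tlevel => ->. Qed.

(** Above level 1 the [insub] in [tparent] never falls back to [None]: halving an index below
    [2 ^ (l - 1)] gives one below [2 ^ (l - 2)]. *)
Lemma tparentS {m} (v : tnode m) : 1 < tlevel v ->
  exists u, [/\ tparent v = Some u, tlevel u = (tlevel v).-1
              & tindex u = (tindex v)./2].
Proof.
move=> l1; have /andP[l0 lm] := tlevelP v; have il := tindexP v.
have l2 : 0 < (tlevel v).-1 by rewrite -ltnS prednK.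
have [||u lu iu] := @tnode_exists m (tlevel v).-1 (tindex v)./2.
- by rewrite l2 (leq_trans (leq_pred _)).
- rewrite ltn_half_double -mul2n -expnS prednK //.
exists u; split=> //; rewrite /tparent -/(tlevel v) -/(tindex v).
rewrite ifN ?gtn_eqF //.
suff -> : (inord (tlevel v - 1), inord (tindex v %/ 2)) = val u by rewrite valK.
have /eqP := erefl (val u); rewrite [X in _ == X]surjective_pairing => /eqP ->.
congr pair; apply: val_inj => /=;
  rewrite inordK -?/(tlevel u) -?/(tindex u) ?lu ?iu ?subn1 ?divn2 //.
  by rewrite ltnS (leq_trans (leq_pred _)).
rewrite -iu; apply: ltn_ord.
Qed.

Lemma iter_period (T : Type) (F : T -> T) (n k : nat) (x : T) :
  iter n F x = x -> iter (k %% n) F x = iter k F x.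
Proof.
move=> nx; rewrite {2}(divn_eq k n) addnC iterD; congr iter.
by elim: (k %/ n) => //= a IH; rewrite mulSn iterD -IH nx.
Qed.

(** Here [lev] is the height above the cycle and [nu] swaps the two points of a fibre. Over a cycle
    point one of the two lies on the cycle and the other has height 1; over a point of height
    strictly between 0 and [m] both lie one level higher. This is the branching of T(m). *)
Lemma models_cyc_trees (T : finType) (F nu : T -> T) (P : {pred T})
    (lev : T -> nat) (n m : nat) :
  0 < n -> {homo F : x / x \in P} -> {homo nu : x / x \in P} ->
  {in P, forall x, lev (F x) = (lev x).-1} ->
  {in P, forall x, lev x <= m} ->
  {in P, forall x, F (nu x) = F x} -> {in P, forall x, nu x <> x} ->
  {in P &, forall x y, F x = F y -> x = y \/ x = nu y} ->
  {in P, forall x, lev x < m -> exists y, [/\ y \in P, F y = x & 0 < lev y]} ->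
  {in P, forall x, lev x = 0 -> 0 < lev (nu x)} ->
  {in P, forall x, lev x = 0 -> forall k, (iter k F x == x) = (n %| k)} ->
  models F (mem P)
    (fg_copies (#|[pred x in P | lev x == 0]| %/ n) (cyc_trees n m)).
Proof.
move=> n_gt0 PF Pnu levF lev_le nuF nu_neq fib up nu0 per.
set C := [pred x in P | lev x == 0].
have CP x : x \in C -> x \in P by case/andP.
have C0 x : x \in C -> lev x = 0 by case/andP=> _ /eqP.
have FC : {homo F : x / x \in C}.
  by move=> x xC; rewrite inE PF ?CP //= levF ?CP // C0.
have F_injC : {in C &, injective F}.
  move=> x y xC yC /fib [||//|xE]; rewrite ?CP //.
  by have := nu0 y (CP _ yC) (C0 _ yC); rewrite -xE C0.
have perC : {in C, forall x k, (iter k F x == x) = (n %| k)}.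
  by move=> x xC; apply: per; rewrite ?CP ?C0.
have [rt [rtC rt_surj rt_inj]] := cycle_transversal _ _ _ _ n_gt0 FC F_injC perC.
have itC j i : iter j F (rt i) \in C by elim: j => //= j; apply: FC.
(* A chosen preimage off the cycle. The condition [0 < lev y] matters only over cycle points, and
   the default [x] is never met below height [m]. *)
pose pr x := odflt x [pick y | [&& y \in P, F y == x & 0 < lev y]].
have prP x : x \in P -> lev x < m ->
    [/\ pr x \in P, F (pr x) = x & lev (pr x) = (lev x).+1].
  move=> xP xm; rewrite /pr; case: pickP => [y /and3P[yP /eqP yx y0]|no] /=.
    by split=> //; rewrite -[in RHS]yx levF // prednK.
  by have [y [yP yx y0]] := up x xP xm; have:= no y; rewrite yP yx eqxx y0.
(* The vertex with index [i] at level [l] above [z]: the parent has index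
   [i./2], and the two points above a vertex are swapped by [nu]. *)
pose fix desc (l i : nat) (z : T) {struct l} : T :=
  if l is l'.+1 then
    let w := desc l' i./2 z in if odd i then nu (pr w) else pr w
  else z.
have half_lt l i : i < 2 ^ l -> i./2 < 2 ^ l.-1.
  case: l => [|l]; first by case: i.
  by rewrite ltn_half_double -mul2n -expnS.
have descP l i z : z \in C -> l <= m -> i < 2 ^ l.-1 ->
    desc l i z \in P /\ lev (desc l i z) = l.
  move=> zC; elim: l i => [|l IH] i; first by move=> _ _; rewrite /= CP ?C0.
  move=> lm il; have [] := IH i./2 (ltnW lm) (half_lt _ _ il).
  rewrite [desc l.+1 _ _]/=; set w := desc l _ _ => wP lw.
  have [|pP Fp lp] := prP w wP; first by rewrite lw.
  case: ifP => odd_i; last by rewrite pP lp lw.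
  split; first exact: Pnu.
  have := levF _ (Pnu _ pP); rewrite nuF // Fp lw.
  (* At level 1 applying [nu] could lead back to the cycle, but the only index there is 0, which is
     even. *)
  have [l0|l0] := posnP l; last by case: (lev _) => [l'0|a ->] //; rewrite l'0 in l0.
  by move: il odd_i; rewrite l0; case: (i) => [|[]].
have descF l i z : z \in C -> l < m -> i < 2 ^ l ->
    F (desc l.+1 i z) = desc l i./2 z.
  move=> zC lm il; have [] := descP l i./2 z zC (ltnW lm) (half_lt _ _ il).
  rewrite [desc l.+1 _ _]/=; set w := desc l _ _ => wP lw.
  have [|pP Fp lp] := prP w wP; first by rewrite lw.
  by case: ifP => _; rewrite ?nuF.
have desc_inj l i i' z z' : z \in C -> z' \in C -> l <= m ->
    i < 2 ^ l.-1 -> i' < 2 ^ l.-1 -> desc l i z = desc l i' z' ->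
    i = i' /\ z = z'.
  move=> zC zC'; elim: l i i' => [|l IH] i i' lm il il' e.
    by case: i i' il il' e => [|i] [|i'].
  have [//|||ei ez] := IH i./2 i'./2 (ltnW lm); rewrite ?half_lt //.
    by rewrite -!descF // e.
  split=> //; rewrite -(odd_double_half i) -(odd_double_half i') ei.
  congr (nat_of_bool _ + _); move: e => /=; rewrite -ei -ez.
  have [wP lw] := descP l i./2 z zC (ltnW lm) (half_lt _ _ il).
  have [|pP _ _] := prP _ wP; first by rewrite lw.
  by case: (odd i); case: (odd i') => //; [move/nu_neq | move/esym/nu_neq]; case.
have desc_surj x : x \in P -> exists z i,
    [/\ z \in C, i < 2 ^ (lev x).-1 & x = desc (lev x) i z].
  have [l] := ubnP (lev x); elim: l x => // l IH x lx xP.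
  case lev_x : (lev x) => [|k].
    by exists x, 0; split=> //; rewrite inE xP /= lev_x.
  have levFx : lev (F x) = k by rewrite levF // lev_x.
  have km : k < m by rewrite -lev_x lev_le.
  have [||z [i []]] := IH (F x).
  - by rewrite levFx -lev_x ltnS in lx *.
  - exact: PF.
  rewrite levFx => zC ik Fx; rewrite /=.
  have [||pP Fp lp] := prP (F x); rewrite ?levFx ?PF //.
  have [xE|xE] := fib _ _ xP pP (esym Fp).
    exists z, i.*2; split=> //; last by rewrite odd_double doubleK -Fx.
    case: k ik {lev_x levFx km lp Fx} => [|k]; first by case: i.
    by rewrite -ltn_double -[X in _ < X]mul2n -expnS.
  exists z, i.*2.+1; split=> //; last by rewrite /= odd_double uphalf_double -Fx.
  case: k ik lev_x levFx km lp Fx => [|k] ik lev_x levFx km lp Fx.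
    have FxC : F x \in C by rewrite inE PF //= levFx.
    (* The predecessor of [F x] on its cycle is in the fibre of [pr (F x)], so it would be
       [pr (F x)] or [x]; both have level 1, a contradiction. *)
    have yC : iter n.-1 F (F x) \in C by elim: n.-1 => //= a; apply: FC.
    have Fy : F (iter n.-1 F (F x)) = F (pr (F x)).
      by rewrite Fp -iterS prednK //; apply/eqP; rewrite perC.
    have [|E|E] := fib _ _ _ pP Fy; first exact: CP.
      by have := C0 _ yC; rewrite E lp levFx.
    by have := C0 _ yC; rewrite E -xE lev_x.
  by rewrite /= expnS mul2n -doubleS leq_double.
(* The root gets level 0 and index 0; since [0.-1 = 0], the bound [2 ^ (lv o).-1] on indices holds
   for it too. *)
pose lv (o : option (tnode m)) := if o is Some v then tlevel v else 0.
pose ix (o : option (tnode m)) := if o is Some v then tindex v else 0.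
have lv_le o : lv o <= m by case: o => //= v; case/andP: (tlevelP v).
have ix_lt o : ix o < 2 ^ (lv o).-1 by case: o => //= v; apply: tindexP.
exists (fun w : 'I_(#|C| %/ n) * ('I_n * option (tnode m)) =>
  desc (lv w.2.2) (ix w.2.2) (iter w.2.1 F (rt w.1))).
split=> [[i [j o]] [i' [j' o']] /= e|x|[i [j [v|]]] /=].
- have elv : lv o = lv o'.
    have [//|_ <-] := descP (lv o) (ix o) _ (itC j i) (lv_le o).
    by have [//|_ <-] := descP (lv o') (ix o') _ (itC j' i') (lv_le o'); rewrite e.
  rewrite -elv in e.
  have := desc_inj _ _ _ _ _ (itC j i) (itC j' i') (lv_le o) _ _ e.
  rewrite {2}elv => /(_ (ix_lt o) (ix_lt o'))[eix /rt_inj[-> ->]].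
  congr (_, (_, _)); move: elv eix; rewrite /lv /ix.
  case: o o' {e} => [v|] [v'|] // => [el ei|e0 _|e0 _].
  + by rewrite (tnode_inj _ _ el ei).
  + by have := tlevelP v; rewrite e0.
  + by have := tlevelP v'; rewrite -e0.
- split=> [/[dup] xP /desc_surj[z [a [zC a_lt xE]]]|[[i [j o]] <-]]; last first.
    by have [] := descP _ _ _ (itC j i) (lv_le o) (ix_lt o).
  have [i [j zE]] := rt_surj z zC.
  case lx : (lev x) => [|l].
    by exists (i, (j, None)); rewrite /= -zE xE lx.
  have [||v lvE ivE] := @tnode_exists m (lev x) a => //.
    by rewrite lev_le ?lx.
  by exists (i, (j, Some v)); rewrite /= lvE ivE -zE.
- have [lv1|lv1] := eqVneq (tlevel v) 1.
    have iv0 : tindex v = 0 by have := tindexP v; rewrite lv1; case: (tindex v).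
    have := descF 0 0 _ (itC j i); rewrite tparent1 //= lv1 iv0 => -> //.
    by have := lv_le (Some v); rewrite /= lv1.
  have /andP[lv0 lvm] := tlevelP v.
  have [|u [-> lu iu]] := tparentS v; first by rewrite ltn_neqAle eq_sym lv1.
  rewrite /= lu iu -descF ?prednK //; last exact: tindexP.
- rewrite -iterS iter_period //; apply/eqP.
  by rewrite perC ?(itC 0).
Qed.

(** * Orders and roots of unity *)

(** By Euler's theorem the exponent [totient m], which is at most [m], is found within the range
    searched by [ord_mod]. Minimality then excludes a nonzero remainder of [k]. *)
Lemma ord_mod_dvd (m a k : nat) :
  0 < m -> coprime a m -> (ord_mod m a %| k) = (a ^ k == 1 %[mod m]).
Proof.
move=> m_gt0 cam; rewrite /ord_mod; set P := fun _ => _; set o := find _ _.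
have hasP : has P (iota 0 m).
  have t_gt0 : 0 < totient m by rewrite totient_gt0.
  apply/hasP; exists (totient m).-1; last by rewrite /P prednK // Euler_exp_totient.
  rewrite mem_iota add0n prednK //= totient_count_coprime big_mkord.
  by rewrite -[leqRHS]card_ord -sum1_card leq_sum // => i _; case: coprime.
have om : o < m by rewrite -[ltnRHS](size_iota 0) -has_find.
have /eqP ao : P o by have := nth_find 0 hasP; rewrite nth_iota.
have amod j : a ^ (j * o.+1) = 1 %[mod m].
  by rewrite mulnC expnM -modnXm ao modnXm exp1n.
have -> : (a ^ k == 1 %[mod m]) = (a ^ (k %% o.+1) == 1 %[mod m]).
  by rewrite {1}(divn_eq k o.+1) expnD -modnMml amod modnMml mul1n.
rewrite /dvdn; case: (posnP (k %% o.+1)) => [->|k_gt0]; first by rewrite eqxx.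
apply/esym/negP=> ak.
have : (k %% o.+1).-1 < o by rewrite prednK // -ltnS ltn_pmod.
move=> ko; have := before_find 0 ko; rewrite nth_iota ?(ltn_trans ko) //.
by rewrite /P add0n prednK // ak.
Qed.

Local Open Scope ring_scope.

(** The [#|F|.-1] nonzero elements are all roots of unity of that exponent, which forces a primitive
    one among them; a suitable power of it has order [n]. *)
Lemma prim_root_finField (F : finFieldType) (n : nat) :
  (0 < n)%N -> (n %| #|F|.-1)%N -> exists w : F, n.-primitive_root w.
Proof.
move=> n_gt0 nF; have F1 : (0 < #|F|.-1)%N.
  by rewrite -(cardC1 0); apply/card_gt0P; exists 1; rewrite !inE oner_eq0.
have /hasP[g _ g_prim] : has #|F|.-1.-primitive_root (enum (predC1 (0 : F))).
  apply: has_prim_root => //; rewrite ?enum_uniq //; last by rewrite -cardE cardC1.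
  apply/allP=> x; rewrite mem_enum inE unity_rootE => x0.
  rewrite -(inj_eq (mulfI x0)) mulr1 -exprS prednK ?expf_card //.
  by rewrite (leq_trans F1) ?leq_pred.
by exists (g ^+ (#|F|.-1 %/ n)); apply: dvdn_prim_root.
Qed.

Lemma card_unity_roots (F : finFieldType) (n : nat) (w : F) :
  n.-primitive_root w -> #|[pred z : F | z ^+ n == 1]| = n.
Proof.
move=> w_prim; have inj : injective (fun i : 'I_n => w ^+ i).
  move=> i j /eqP; rewrite (eq_prim_root_expr w_prim) !modn_small // => /eqP.
  exact: val_inj.
rewrite -[RHS]card_ord -(card_codom inj); apply: eq_card => z; rewrite inE.
apply/eqP/codomP=> [/(prim_rootP w_prim)[i ->]|[i ->]]; first by exists i.
by rewrite exprAC (prim_expr_order w_prim) expr1n.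
Qed.

Lemma card_prim_roots (F : finFieldType) (n : nat) (w : F) :
  n.-primitive_root w -> #|[pred z : F | n.-primitive_root z]| = totient n.
Proof.
move=> w_prim; have inj : injective (fun i : 'I_n => w ^+ i).
  move=> i j /eqP; rewrite (eq_prim_root_expr w_prim) !modn_small // => /eqP.
  exact: val_inj.
transitivity #|[pred i : 'I_n | coprime n i]|; last first.
  rewrite -sum1_card totient_count_coprime big_mkord big_mkcond.
  by apply: eq_bigr => i _; rewrite inE; case: coprime.
rewrite -(card_image inj); apply: eq_card => z; rewrite inE.
apply/idP/imageP=> [z_prim|[i ci ->]].
  have [i zE] := prim_rootP w_prim (prim_expr_order z_prim).
  exists i => //; rewrite inE coprime_sym.
  by rewrite -(prim_root_exp_coprime _ w_prim) -zE.
by rewrite (prim_root_exp_coprime _ w_prim) coprime_sym.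
Qed.

Lemma prim_root_half (F : fieldType) (n : nat) (w : F) :
  n.*2.-primitive_root w -> w ^+ n = -1.
Proof.
move=> w_prim; have /eqP := prim_expr_order w_prim.
rewrite -muln2 exprM sqrf_eq1 => /orP[|/eqP //].
rewrite -(prim_order_dvd w_prim) => /dvdn_leq.
have := prim_order_gt0 w_prim; rewrite double_gt0 => n_gt0 /(_ n_gt0).
by rewrite leqNgt -addnn -[ltnLHS]addn0 ltn_add2l n_gt0.
Qed.

Lemma prim_root_unique (R : nzRingType) (m n : nat) (z : R) :
  m.-primitive_root z -> n.-primitive_root z -> m = n.
Proof.
move=> mz nz; apply/eqP; rewrite eqn_dvd (prim_order_dvd mz) (prim_order_dvd nz).
by rewrite (prim_expr_order mz) (prim_expr_order nz) eqxx.
Qed.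

(** Serves with [k] a power of 2 and [r] odd: such powers preserve the order of an [r]-th root of
    unity. *)
Lemma prim_root_coprime_expr (R : nzRingType) (d k r : nat) (u : R) :
  (0 < r)%N -> coprime k r -> u ^+ r = 1 ->
  d.-primitive_root (u ^+ k) = d.-primitive_root u.
Proof.
move=> r_gt0 ckr ur; have [e eu er] := prim_order_exists r_gt0 ur.
have euk : e.-primitive_root (u ^+ k).
  by rewrite (prim_root_exp_coprime _ eu) (coprime_dvdr er).
by apply/idP/idP=> du; [rewrite (prim_root_unique _ _ _ _ du euk)
  | rewrite (prim_root_unique _ _ _ _ du eu)].
Qed.

(** * The 2-part of the order of a root of unity *)

Section Level.

Variables (K : finFieldType) (s r : nat).

(** For odd [r] and [y ^+ (2 ^ s * r) = 1] this is the exponent of 2 in the order of [y]. A failed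
    search returns [s], which is then the correct value. *)
Definition level (y : K) : nat := find (fun l => y ^+ (2 ^ l * r) == 1) (iota 0 s).

Lemma level_leq (y : K) (l : nat) :
  y ^+ (2 ^ s * r) = 1 -> (level y <= l)%N = (y ^+ (2 ^ l * r) == 1).
Proof.
move=> ys; set P := fun l => y ^+ (2 ^ l * r) == 1.
have mono a b : (a <= b)%N -> P a -> P b.
  move=> ab /eqP ya; rewrite /P -(subnK ab) expnD -mulnA mulnC exprM ya.
  by rewrite expr1n.
have le_s : (level y <= s)%N by rewrite -[leqRHS](size_iota 0) find_size.
have Plev : P (level y).
  have [levs|] := ltnP (level y) s; last first.
    by move=> /(conj le_s)/andP; rewrite -eqn_leq => /eqP->; apply/eqP.
  have := nth_find 0%N; move/(_ P (iota 0 s)).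
  by rewrite has_find size_iota nth_iota //; apply.
apply/idP/idP; first by move=> /mono; apply.
move=> Pl; rewrite leqNgt; apply/negP=> ll.
by have := before_find 0%N ll; rewrite nth_iota ?(leq_trans ll) // Pl.
Qed.

Lemma level_le (y : K) : (level y <= s)%N.
Proof. by rewrite -[leqRHS](size_iota 0) find_size. Qed.

Lemma level_eq0 (y : K) :
  y ^+ (2 ^ s * r) = 1 -> (level y == 0%N) = (y ^+ r == 1).
Proof. by move=> ys; rewrite -leqn0 level_leq // mul1n. Qed.

Lemma level_sqr (y : K) :
  y ^+ (2 ^ s * r) = 1 -> level (y ^+ 2) = (level y).-1.
Proof.
move=> ys; have y2s : (y ^+ 2) ^+ (2 ^ s * r) = 1 by rewrite exprAC ys expr1n.
have lev l : (level (y ^+ 2) <= l)%N = (level y <= l.+1)%N.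
  by rewrite !level_leq // -exprM mulnA -expnS.
apply/eqP; rewrite eqn_leq lev leqSpred -subn1 leq_subLR add1n -lev.
exact: leqnn.
Qed.

(** As [r] is odd, [y ^+ r = 1] gives [(- y) ^+ r = -1], which is not 1. *)
Lemma level_opp (y : K) : 2%:R != 0 :> K -> odd r ->
  y ^+ (2 ^ s * r) = 1 -> (0 < s)%N -> level y = 0%N -> (0 < level (- y))%N.
Proof.
move=> K2 odd_r ys s_gt0 /eqP; rewrite level_eq0 // => /eqP yr.
rewrite lt0n level_eq0; last first.
  by rewrite exprNn -signr_odd oddM oddX (gtn_eqF s_gt0) expr0 mul1r.
rewrite exprNn -signr_odd odd_r expr1 yr mulr1 eq_sym -subr_eq0 opprK.
by rewrite -(natrD _ 1 1).
Qed.

(** Write [y = w ^+ i]. A level below [s] makes [i] even, so [y] has a square root among the powers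
    of [w]; if that root has level 0, its opposite does not. *)
Lemma level_sqrt (w y : K) : 2%:R != 0 :> K -> odd r ->
  (2 ^ s * r).-primitive_root w -> y ^+ (2 ^ s * r) = 1 -> (level y < s)%N ->
  exists z, [/\ z ^+ 2 = y, z ^+ (2 ^ s * r) = 1 & (0 < level z)%N].
Proof.
move=> K2 odd_r w_prim ys lev_y.
have s_gt0 : (0 < s)%N by apply: leq_ltn_trans lev_y.
have [i yE] := prim_rootP w_prim ys.
have /dvdnP[j iE] : (2 %| i)%N.
  have : (level y <= s.-1)%N by rewrite -ltnS prednK.
  rewrite level_leq // yE -exprM -(prim_order_dvd w_prim) -{1}(prednK s_gt0).
  rewrite expnS -mulnA dvdn_pmul2r // muln_gt0 expn_gt0 /=.
  by case: (r) odd_r.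
have z2 : (w ^+ j) ^+ 2 = y by rewrite -exprM -iE.
have zs : (w ^+ j) ^+ (2 ^ s * r) = 1 by rewrite exprAC (prim_expr_order w_prim) expr1n.
have [l0|l0] := posnP (level (w ^+ j)); last by exists (w ^+ j).
exists (- w ^+ j); rewrite sqrrN; split=> //; last exact: level_opp.
by rewrite exprNn -signr_odd oddM oddX (gtn_eqF s_gt0) expr0 mul1r.
Qed.

End Level.

(** * The map c (X ^ (q + 1) - X ^ 2) *)

Section QuadraticMap.

Variables (K : finFieldType) (q : nat) (c : K).
Hypothesis q_gt1 : (1 < q)%N.
Hypothesis odd_q : odd q.
Hypothesis cardK : #|K| = (q ^ 2)%N.
Hypothesis frobD : forall x y : K, (x + y) ^+ q = x ^+ q + y ^+ q.
Hypothesis c_neq0 : c != 0.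
Hypothesis c_frob : c ^+ q = c.

Let f (x : K) := c * (x ^+ q.+1 - x ^+ 2).

Definition tr (x : K) := x + x ^+ q.
Definition di (x : K) := x - x ^+ q.
Definition mult (x : K) := - c ^+ 3 * tr x * di x ^+ 2.
Definition torus (x : K) := (tr x != 0) && (di x != 0).

Lemma q_gt0 : (0 < q)%N. Proof. exact: ltnW. Qed.

Lemma q1_gt0 : (0 < q.-1)%N. Proof. by rewrite -ltnS prednK // q_gt0. Qed.

Lemma cardK1 : #|K|.-1 = (q.-1 * q.+1)%N.
Proof. by rewrite cardK -subn1 -(exp1n 2) subn_sqr subn1 addn1. Qed.

Lemma frobN (x : K) : (- x) ^+ q = - x ^+ q.
Proof. by rewrite exprNn -signr_odd odd_q expr1 mulN1r. Qed.

Lemma frobB (x y : K) : (x - y) ^+ q = x ^+ q - y ^+ q.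
Proof. by rewrite frobD frobN. Qed.

Lemma frobK (x : K) : (x ^+ q) ^+ q = x.
Proof. by rewrite -exprM mulnn -cardK expf_card. Qed.

(** Holds because [q.+1] is even. It supplies a primitive root of order [q.-1.*2], whose power
    [q.-1] is -1. *)
Lemma dvd2_q1 : (q.-1.*2 %| #|K|.-1)%N.
Proof. by rewrite cardK1 -muln2 dvdn_pmul2l ?q1_gt0 // dvdn2 /= odd_q. Qed.

Lemma two_neq0 : 2%:R != 0 :> K.
Proof.
have [|w w_prim] := @prim_root_finField K (1.*2) isT.
  by apply: dvdn_trans dvd2_q1; rewrite -!muln2 dvdn_mul ?dvd1n.
have := prim_order_dvd w_prim 1; rewrite (prim_root_half _ _ _ w_prim) => /esym.
by rewrite eq_sym -subr_eq0 opprK -(natrD _ 1 1) => /negbT.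
Qed.

(** * The map in the coordinates [tr] and [di] *)

Lemma tr_frob (x : K) : tr x ^+ q = tr x.
Proof. by rewrite frobD frobK addrC. Qed.

Lemma di_frob (x : K) : di x ^+ q = - di x.
Proof. by rewrite frobB frobK opprB. Qed.

Lemma f_frob (x : K) : f x ^+ q = c * (x ^+ q * x - (x ^+ q) ^+ 2).
Proof. by rewrite exprMn c_frob frobB exprS exprMn frobK exprAC. Qed.

Lemma tr_f (x : K) : tr (f x) = - c * di x ^+ 2.
Proof. by rewrite /tr f_frob /f /di exprS; ring. Qed.

Lemma di_f (x : K) : di (f x) = - c * tr x * di x.
Proof. by rewrite /di f_frob /f /tr exprS; ring. Qed.

Lemma f_di (x : K) : f x = - c * di x * x.
Proof. by rewrite /f /di exprS; ring. Qed.

Lemma mult_f (x : K) : mult (f x) = mult x ^+ 2.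
Proof. by rewrite /mult tr_f di_f; ring. Qed.

Lemma f_f (x : K) : f (f x) = mult x * x.
Proof. by rewrite f_di di_f f_di /mult; ring. Qed.

Lemma mult_iter (x : K) (j : nat) : mult (iter j f x) = mult x ^+ (2 ^ j).
Proof. by elim: j => //= j IH; rewrite mult_f IH -exprM expnSr. Qed.

(** Two steps multiply a point by its [mult] and raise [mult] to the fourth power, so the successive
    factors have exponents 1, 4, 16 and so on. *)
Lemma iter_double_f (x : K) (m : nat) :
  iter m.*2 f x = mult x ^+ (\sum_(i < m) 4 ^ i) * x.
Proof.
elim: m => [|m IH]; first by rewrite big_ord0 expr0 mul1r.
rewrite doubleS [LHS]/= f_f mult_iter IH big_ord_recr /= addnC exprD mulrA.
by rewrite -mul2n expnM.
Qed.

Lemma tr_di_inj (x y : K) : tr x = tr y -> di x = di y -> x = y.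
Proof.
move=> et ed; apply: (mulfI two_neq0).
have E z : 2%:R * z = tr z + di z by rewrite /tr /di; ring.
by rewrite !E et ed.
Qed.

Lemma tr_di_surj (t d : K) : t ^+ q = t -> d ^+ q = - d ->
  exists x, tr x = t /\ di x = d.
Proof.
move=> tq dq; exists ((t + d) / 2%:R).
have two_frob : 2%:R ^+ q = 2%:R :> K by rewrite (natrD _ 1 1) frobD !expr1n.
have K2 := two_neq0.
by rewrite /tr /di exprMn exprVn two_frob frobD tq dq; split; field.
Qed.

Lemma tr_opp (x : K) : tr (- x) = - tr x.
Proof. by rewrite /tr frobN opprD. Qed.

Lemma di_opp (x : K) : di (- x) = - di x.
Proof. by rewrite /di frobN opprD. Qed.

Lemma mult_opp (x : K) : mult (- x) = - mult x.
Proof. by rewrite /mult tr_opp di_opp; ring. Qed.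

Lemma f_opp (x : K) : f (- x) = f x.
Proof. by rewrite !f_di di_opp; ring. Qed.

(** [tr (f x)] determines [di x] up to sign; since [di x] is nonzero, [di (f x)] then determines
    [tr x] with the same sign. *)
Lemma f_fiber (x y : K) : torus x -> f x = f y -> x = y \/ x = - y.
Proof.
case/andP=> tx dx exy; have c2 : - c != 0 by rewrite oppr_eq0.
have := congr1 tr exy; rewrite !tr_f => /(mulfI c2)/eqP.
have := congr1 di exy; rewrite !di_f -!mulrA => /(mulfI c2) et.
rewrite eqf_sqr => /orP[]/eqP ed; rewrite ed in et dx.
  by left; apply: tr_di_inj ed; apply: mulIf et.
right; apply: tr_di_inj; rewrite ?tr_opp ?di_opp //.
have dy : di y != 0 by rewrite oppr_eq0 in dx.
by apply: (mulIf dy); rewrite mulNr -et mulrN opprK.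
Qed.

Lemma torus_opp (x : K) : torus (- x) = torus x.
Proof. by rewrite /torus tr_opp di_opp !oppr_eq0. Qed.

Lemma torus_f (x : K) : torus (f x) = torus x.
Proof.
rewrite /torus tr_f di_f !mulf_eq0 !oppr_eq0 (negbTE c_neq0) /=.
by case: (tr x == 0); case: (di x == 0).
Qed.

(** * Points off the axes, their multipliers and their periods *)

Lemma frob_fix (x : K) : x != 0 -> (x ^+ q == x) = (x ^+ q.-1 == 1).
Proof.
by move=> x0; rewrite -{1}(prednK q_gt0) exprS -{3}(mulr1 x) (inj_eq (mulfI x0)).
Qed.

Lemma frob_anti (x : K) : x != 0 -> (x ^+ q == - x) = (x ^+ q.-1 == -1).
Proof.
by move=> x0; rewrite -{1}(prednK q_gt0) exprS -(mulrN1 x) (inj_eq (mulfI x0)).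
Qed.

Lemma mult_neq0 (x : K) : torus x -> mult x != 0.
Proof.
by case/andP=> t0 d0; rewrite !mulf_neq0 ?oppr_eq0 ?expf_neq0.
Qed.

Lemma mult_unity (x : K) : torus x -> mult x ^+ q.-1 = 1.
Proof.
move=> xT; apply/eqP; rewrite -frob_fix ?mult_neq0 //; apply/eqP.
rewrite /mult !exprMn frobN !(exprAC _ _ q) c_frob tr_frob di_frob; ring.
Qed.

Lemma torus_neq0 (x : K) : torus x -> x != 0.
Proof.
move=> xT; apply/eqP=> x0; move: xT.
by rewrite x0 /torus /tr expr0n gtn_eqF ?q_gt0 // addr0 eqxx.
Qed.

Lemma torus_point (z d : K) : z ^+ q.-1 = 1 -> d ^+ q.-1 = -1 ->
  exists x, [/\ torus x, mult x = z & di x = d].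
Proof.
move=> zq dq; have q1 : q.-1 != 0%N by rewrite -lt0n q1_gt0.
have z0 : z != 0.
  by apply/eqP=> z0; move/eqP: zq; rewrite z0 expr0n (negbTE q1) eq_sym oner_eq0.
have d0 : d != 0.
  by apply/eqP=> d0; move/eqP: dq; rewrite d0 expr0n (negbTE q1) eq_sym oppr_eq0 oner_eq0.
have /eqP zF : z ^+ q == z by rewrite frob_fix // zq.
have /eqP dF : d ^+ q == - d by rewrite frob_anti // dq.
(* This trace solves [mult x = z] for [di x = d]; it is fixed by Frobenius because [d ^+ 2] is. *)
have [|x [tx dx]] := tr_di_surj (- z / (c ^+ 3 * d ^+ 2)) d _ dF.
  by rewrite exprMn exprVn frobN exprMn !(exprAC _ _ q) zF c_frob dF sqrrN.
exists x; rewrite /torus /mult tx dx d0 andbT mulf_neq0 ?oppr_eq0 //; last first.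
  by rewrite invr_eq0 mulf_neq0 ?expf_neq0.
by split=> //; field; rewrite c_neq0 d0.
Qed.

Lemma torus_inj (x y : K) : torus x -> mult x = mult y -> di x = di y -> x = y.
Proof.
case/andP=> _ dx em ed; apply: tr_di_inj (ed); move: em.
rewrite /mult -ed => /(mulIf (expf_neq0 2 dx))/mulfI; apply.
by rewrite oppr_eq0 expf_neq0.
Qed.

(** The solutions form a coset of the group of roots of unity of exponent [q.-1]. *)
Lemma card_anti : #|[pred d : K | d ^+ q.-1 == -1]| = q.-1.
Proof.
have q2 : (0 < q.-1.*2)%N by rewrite double_gt0 q1_gt0.
have [g g_prim] := prim_root_finField K _ q2 dvd2_q1.
have gq := prim_root_half _ _ _ g_prim.
have g0 : g != 0 by rewrite (prim_root_eq0 g_prim) -lt0n.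
have [|w w_prim] := prim_root_finField K q.-1 q1_gt0; first by rewrite cardK1 dvdn_mulr.
rewrite -[RHS](card_unity_roots _ _ _ w_prim) -(card_image (mulfI g0)).
apply: eq_card => d; rewrite inE.
apply/imageP/eqP=> [[u /eqP uq ->]|dq]; first by rewrite exprMn uq gq mulrNN mulr1.
exists (d / g); last by rewrite mulrC divfK.
by rewrite inE exprMn exprVn dq gq mul1r invrN1.
Qed.

Lemma f_scale (a x : K) : a ^+ q = a -> f (a * x) = a ^+ 2 * f x.
Proof.
by move=> aq; rewrite !f_di /di exprMn aq; ring.
Qed.

(** The iterate is [x] times [- c * a ^+ 2 * di x], with [a] and [c] fixed by Frobenius. This factor
    changes sign under Frobenius, so it cannot be 1. *)
Lemma iter_odd_f (x : K) (m : nat) : torus x -> iter m.*2.+1 f x != x.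
Proof.
move=> xT; rewrite iterS iter_double_f f_scale; last first.
  rewrite exprAC; congr (_ ^+ _); apply/eqP.
  by rewrite frob_fix ?mult_neq0 // mult_unity.
set a := _ ^+ (\sum_(i < m) _); have aq : a ^+ q = a.
  rewrite exprAC; congr (_ ^+ _); apply/eqP.
  by rewrite frob_fix ?mult_neq0 // mult_unity.
have K2 := two_neq0.
rewrite f_di mulrA -{3}(mul1r x) (inj_eq (mulIf (torus_neq0 _ xT))).
have bq : (a ^+ 2 * - c) ^+ q = a ^+ 2 * - c by rewrite exprMn exprAC aq frobN c_frob.
rewrite mulrA; apply/eqP=> e; have := congr1 (fun z => z ^+ q) e => /=.
rewrite exprMn bq di_frob expr1n mulrN e => /eqP.
by rewrite -subr_eq0 -opprD oppr_eq0 -(natrD _ 1 1) (negbTE K2).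
Qed.

Lemma iter_f_eq (x : K) (d k : nat) :
  torus x -> d.-primitive_root (mult x) -> odd d ->
  (iter k f x == x) = (2 * ord_mod (3 * d) 4 %| k)%N.
Proof.
move=> xT x_prim odd_d; have d_gt0 := prim_order_gt0 x_prim.
rewrite -(odd_double_half k); case: (odd k) => /=; last first.
  rewrite add0n iter_double_f -{3}(mul1r x) (inj_eq (mulIf (torus_neq0 _ xT))).
  rewrite -(prim_order_dvd x_prim) -mul2n dvdn_pmul2l // ord_mod_dvd; last 2 first.
  - by rewrite muln_gt0.
  - by rewrite coprimeMr [coprime 4 d](@coprimeXl 2 2) ?coprime2n.
  (* The geometric sum times 3 is [4 ^ k./2 - 1], whence the modulus [3 * d]. *)
  rewrite eqn_mod_dvd ?expn_gt0 // subn1 (predn_exp 4) dvdn_pmul2l //.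
rewrite add1n (negbTE (iter_odd_f _ _ xT)); apply/esym/negP=> dv.
have : (2 %| k./2.*2.+1)%N by apply: dvdn_trans dv; rewrite dvdn_mulr.
by rewrite dvdn2 /= odd_double.
Qed.

Lemma card_torus_prim (d : nat) : (d %| q.-1)%N ->
  #|[pred x | torus x && d.-primitive_root (mult x)]| = (totient d * q.-1)%N.
Proof.
move=> dq; have d_gt0 : (0 < d)%N by apply: dvdn_gt0 dq; apply: q1_gt0.
have [|w w_prim] := prim_root_finField K d d_gt0.
  by rewrite cardK1 dvdn_mulr.
rewrite -(card_prim_roots _ _ _ w_prim) -card_anti -cardX.
have mi_inj : {in [pred x | torus x && d.-primitive_root (mult x)] &,
    injective (fun x => (mult x, di x))}.
  by move=> x y /andP[xT _] _ [em ed]; apply: torus_inj.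
rewrite -(card_in_image mi_inj); apply: eq_card => -[z e]; rewrite !inE /=.
apply/imageP/andP=> [[x]|[z_prim /eqP eq]].
  rewrite inE => /andP[xT xd] [-> ->]; split=> //.
  by rewrite -frob_anti ?di_frob //; case/andP: xT.
have [|x [xT xz xe]] := torus_point z e _ eq.
  by apply/eqP; rewrite -(prim_order_dvd z_prim).
by exists x; rewrite ?xz ?xe // inE xT xz.
Qed.

(** The order of [mult x ^+ (2 ^ s)] is the odd part of the order of [mult x]. It is unchanged by
    [f] and by negation, so it is constant on components, and on cycle points it is the order of
    [mult x] itself. *)
Lemma models_torus (s r d : nat) :
  q.-1 = (2 ^ s * r)%N -> odd r -> (d %| r)%N ->
  models f (fun x => torus x && d.-primitive_root (mult x ^+ (2 ^ s)))
    (fg_copies (totient d * q.-1 %/ (2 * ord_mod (3 * d) 4))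
       (cyc_trees (2 * ord_mod (3 * d) 4) s)).
Proof.
move=> qE odd_r dr; have r_gt0 : (0 < r)%N by case: (r) odd_r.
have odd_d : odd d by apply: dvdn_odd dr odd_r.
have d_gt0 : (0 < d)%N by apply: dvdn_gt0 dr.
have s_gt0 : (0 < s)%N.
  rewrite lt0n; apply: contraTneq odd_q => s0.
  by rewrite -(prednK q_gt0) qE s0 mul1n /= odd_r.
have c2r k : coprime (2 ^ k) r by rewrite coprimeXl // coprime2n.
have unity x : torus x -> mult x ^+ (2 ^ s * r) = 1 by rewrite -qE; apply: mult_unity.
have primE x : torus x -> level K s r (mult x) = 0%N ->
    d.-primitive_root (mult x ^+ (2 ^ s)) = d.-primitive_root (mult x).
  move=> xT /eqP; rewrite level_eq0 ?unity // => /eqP xr.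
  exact: (prim_root_coprime_expr _ _ _ _ _ r_gt0).
have primE2 y : y ^+ (2 ^ s * r) = 1 ->
    d.-primitive_root ((y ^+ 2) ^+ (2 ^ s)) = d.-primitive_root (y ^+ (2 ^ s)).
  move=> ys; rewrite exprAC (prim_root_coprime_expr _ _ _ r) ?coprime2n //.
  by rewrite -exprM.
set P := fun x => _.
have <- : #|[pred x in P | level K s r (mult x) == 0%N]| = (totient d * q.-1)%N.
  rewrite -card_torus_prim; last by rewrite qE dvdn_mull.
  apply: eq_card => x; rewrite !inE /P unfold_in; apply/andP/andP.
    by case=> /andP[xT xp] /eqP l0; rewrite xT -primE.
  case=> xT xp; have l0 : level K s r (mult x) == 0%N.
    rewrite level_eq0 ?unity // -(prim_order_dvd xp) //.
  by rewrite xT primE // (eqP l0).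
have [w w_prim] : exists w : K, (2 ^ s * r).-primitive_root w.
  by rewrite -qE; apply: prim_root_finField; rewrite ?q1_gt0 // cardK1 dvdn_mulr.
(* Negation swaps the points of a fibre, and the height is the level of [mult x], which drops by one
   when [mult x] is squared. *)
apply: eq_models (models_cyc_trees _ _ -%R P (fun x => level K s r (mult x))
  _ _ _ _ _ _ _ _ _ _ _ _ _) => //.
- move=> x /andP[xT xp]; apply/andP; rewrite torus_f mult_f primE2 ?unity //.
- move=> x /andP[xT xp]; apply/andP; rewrite torus_opp mult_opp exprNn -signr_odd.
  by rewrite oddX (gtn_eqF s_gt0) mul1r.
- by move=> x /andP[xT _]; rewrite mult_f level_sqr ?unity.
- by move=> x _; apply: level_le.
- by move=> x _; apply: f_opp.
- move=> x /andP[xT _] /eqP; rewrite -subr_eq0 -opprD oppr_eq0 -mulr2n -mulr_natl.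
  by rewrite mulf_eq0 (negbTE two_neq0) (negbTE (torus_neq0 _ xT)).
- by move=> x y /andP[xT _] _; apply: f_fiber.
- move=> x /andP[xT xp] lx.
  have [z [z2 zs z_lev]] := level_sqrt _ _ _ _ _ two_neq0 odd_r w_prim (unity _ xT) lx.
  have [tx dx] := andP xT; have z0 : z != 0.
    by have := mult_neq0 _ xT; rewrite -z2 expf_eq0.
  (* Since [mult y = c ^+ 2 * di y * di (f y)], a preimage [y] of [x] with [mult y = z] must have
     this [di y]. *)
  have [||y [yT yz yd]] := torus_point z (z / (c ^+ 2 * di x)).
  - by rewrite qE.
  - have cq : c ^+ q.-1 = 1 by apply/eqP; rewrite -frob_fix // c_frob.
    have dq : di x ^+ q.-1 = -1 by apply/eqP; rewrite -frob_anti // di_frob.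
    rewrite exprMn exprVn [(c ^+ 2 * _) ^+ _]exprMn (exprAC _ 2) cq dq expr1n.
    by rewrite qE zs !mul1r invrN1.
  exists y; rewrite unfold_in /P yT yz z_lev -primE2 // z2; split=> //.
  apply/esym/torus_inj => //; first by rewrite mult_f yz z2.
  have /andP[_ dy] := yT; have c2dy : c ^+ 2 * di y != 0 by rewrite mulf_neq0 ?expf_neq0.
  apply: (mulfI c2dy); rewrite di_f; transitivity z.
    by rewrite yd; field; rewrite dx c_neq0.
  by rewrite -yz /mult; ring.
- by move=> x /andP[xT _]; rewrite mult_opp; apply: level_opp; rewrite ?unity ?two_neq0.
- by move=> x /andP[xT xp] l0 k; apply: iter_f_eq; rewrite // -primE.
Qed.

(** * Points on the axes *)

Lemma f_di0 (x : K) : di x = 0 -> f x = 0.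
Proof. by move=> dx; rewrite f_di dx mulr0 mul0r. Qed.

Lemma f_anti (x : K) : x ^+ q = - x -> f x = - (2%:R * c) * x ^+ 2.
Proof. by move=> xq; rewrite f_di /di xq; ring. Qed.

(** Points with [di x = 0] go to 0. Nonzero points with [tr x = 0] go two-to-one, by
    [- (2%:R * c) * x ^+ 2], onto half of the nonzero elements of F_q. That half is the first level
    of the copies of T(2); the other half gives the copies of T(1). *)
Lemma models_axes : models f (fun x => ~~ torus x) (Zgraph q).
Proof.
set m := q.-1./2; have mE : m.*2 = q.-1.
  rewrite -[RHS]odd_double_half -/m.
  by move: odd_q; rewrite -{1}(prednK q_gt0) /= => /negbTE->.
have [g g_prim] : exists g : K, q.-1.*2.-primitive_root g.
  by apply: prim_root_finField; rewrite ?dvd2_q1 // double_gt0 q1_gt0.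
have gq := prim_root_half _ _ _ g_prim.
have g0 : g != 0 by rewrite (prim_root_eq0 g_prim) double_eq0 -lt0n q1_gt0.
pose w := g ^+ 2; have w_prim : q.-1.-primitive_root w.
  have := dvdn_prim_root g_prim (_ : q.-1 %| q.-1.*2)%N.
  by rewrite -muln2 dvdn_mulr // mulKn ?q1_gt0 //; apply.
have w0 : w != 0 by rewrite expf_neq0.
(* Chosen so that [f (g * w ^+ e) = u * w ^+ e.*2]. *)
pose u := - (2%:R * c) * w; have u0 : u != 0.
  by rewrite !mulf_neq0 // oppr_eq0 mulf_neq0 ?two_neq0.
have fixE x : (di x == 0) = (x ^+ q == x) by rewrite /di subr_eq0 eq_sym.
have antiE x : (tr x == 0) = (x ^+ q == - x) by rewrite /tr addrC addr_eq0.
have wq e : (w ^+ e) ^+ q.-1 = 1 by rewrite exprAC (prim_expr_order w_prim) expr1n.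
have uq : u ^+ q.-1 = 1.
  apply/eqP; rewrite -frob_fix // exprMn frobN exprMn c_frob.
  rewrite (natrD _ 1 1) frobD !expr1n -(natrD _ 1 1) (_ : w ^+ q = w) //.
  by apply/eqP; rewrite frob_fix // -(expr1 w) wq.
(* For [e < q.-1], [pt true] runs through the nonzero points with [tr x = 0] and [pt false] through
   those with [di x = 0]. *)
pose pt (b : bool) e := (if b then g else u) * w ^+ e.
have pt0 b e : pt b e != 0 by rewrite mulf_neq0 ?expf_neq0 //; case: b.
have pt_di e : di (pt false e) = 0.
  by apply/eqP; rewrite fixE frob_fix // exprMn uq wq mulr1.
have pt_anti e : pt true e ^+ q = - pt true e.
  by apply/eqP; rewrite frob_anti // exprMn gq wq mulr1.
have pt_tr e : tr (pt true e) = 0 by apply/eqP; rewrite antiE pt_anti.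
have pt_inj b b' e e' : (e < q.-1)%N -> (e' < q.-1)%N -> pt b e = pt b' e' ->
    b = b' /\ e = e'.
  move=> eq e'q E; have bb : b = b'.
    have ne a a' : pt true a != pt false a'.
      apply/eqP=> E'; have /eqP := pt_di a'; rewrite fixE => /eqP pq.
      have /eqP := pt_tr a; rewrite E' /tr pq -mulr2n -mulr_natl mulf_eq0.
      by rewrite (negbTE two_neq0) (negbTE (pt0 _ _)).
    case: b b' E => -[] // E; first by have := ne e e'; rewrite E eqxx.
    by have := ne e' e; rewrite E eqxx.
  split=> //; move: E; rewrite /pt bb => /mulfI; rewrite (fun_if (fun z => z != 0)) g0 u0.
  by case: b' {bb} => /(_ isT)/eqP;
    rewrite (eq_prim_root_expr w_prim) !modn_small // => /eqP.
(* Among the [u * w ^+ e], odd [e] are not reached and form T(1). The value [u * w ^+ i.*2] is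
   reached from the exponents [i] and [i + m], as [m.*2 = q.-1]. *)
pose code (v : 'I_m * tnode 1 + 'I_m * tnode 2) : bool * nat :=
  match v with
  | inl (i, _) => (false, i.*2.+1)
  | inr (i, t) => if tlevel t == 1%N then (false, i.*2) else (true, i + tindex t * m)%N
  end.
have lvl1 (t : tnode 1) : tlevel t = 1%N /\ tindex t = 0%N.
  have := tlevelP t; have := tindexP t; case: (tlevel t) => [|[|l]] //=.
  by case: (tindex t).
have lvl2 (t : tnode 2) : tlevel t != 1%N -> tlevel t = 2%N /\ (tindex t < 2)%N.
  by have := tlevelP t; have := tindexP t; case: (tlevel t) => [|[|[|l]]].
have lvl21 (t : tnode 2) : tlevel t = 1%N -> tindex t = 0%N.
  by move=> t1; have := tindexP t; rewrite t1; case: (tindex t).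
have code_lt v : ((code v).2 < q.-1)%N.
  rewrite -mE; case: v => -[i t] /=; first by rewrite ltn_Sdouble.
  case: eqVneq => [_|/lvl2[_ t2]] /=; first by rewrite ltn_double.
  rewrite -addnn -addSn leq_add // -[leqRHS]mul1n leq_mul2r -ltnS t2 orbT //.
have code_inj : injective code.
  case=> -[i t] [] [i' t'] /=.
  - move=> [/double_inj/val_inj->]; congr (inl (_, _)).
    have [[l0 x0] [l1 x1]] := (lvl1 t, lvl1 t').
    by apply: tnode_inj; rewrite ?l0 ?l1 ?x0 ?x1.
  - by case: eqVneq => // _ [/(congr1 odd)]; rewrite /= !odd_double.
  - by case: eqVneq => // _ [/(congr1 odd)]; rewrite /= !odd_double.
  case: eqVneq => [t1|/lvl2[t2 x2]]; case: eqVneq => [t1'|/lvl2[t2' x2']] // [].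
    move=> /double_inj/val_inj->; congr (inr (_, _)).
    by apply: tnode_inj; rewrite ?t1 ?t1' ?(lvl21 t) ?(lvl21 t').
  move=> E; have tt : tindex t = tindex t'.
    have := congr1 (divn^~ m) E.
    have m_gt0 : (0 < m)%N by apply: leq_ltn_trans (ltn_ord i).
    by rewrite !divnDMl // !divn_small.
  move: E; rewrite tt => /addIn/val_inj->; congr (inr (_, _)).
  by apply: tnode_inj; rewrite ?t2 ?t2'.
exists (fun v : option ('I_m * tnode 1 + 'I_m * tnode 2) =>
  if v is Some a then pt (code a).1 (code a).2 else 0).
split=> [[a|] [b|]||[a|] /=] //.
- move=> /(pt_inj _ _ _ _ (code_lt a) (code_lt b))[e1 e2]; congr Some.
  by apply: code_inj; rewrite [LHS]surjective_pairing [RHS]surjective_pairing e1 e2.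
- by move/eqP; rewrite (negbTE (pt0 _ _)).
- by move/esym/eqP; rewrite (negbTE (pt0 _ _)).
- move=> x; split=> [|[[a|] <-]]; last first.
  + by apply/negP=> /torus_neq0; rewrite eqxx.
  + by rewrite /torus; case: (code a).1; rewrite ?pt_di ?pt_tr eqxx ?andbF.
  have [->|x0] := eqVneq x 0; first by exists None.
  rewrite negb_and !negbK antiE fixE frob_fix ?frob_anti // => /orP[]/eqP xq.
    have [|e xe] := prim_rootP w_prim (_ : (x / g) ^+ q.-1 = 1).
      by rewrite exprMn exprVn xq gq mulN1r invrN1 opprK.
    have xE : x = pt true e by rewrite /pt -xe mulrC divfK.
    have [em|me] := ltnP e m.
      have [||t t2 t0] := @tnode_exists 2 2 0 => //.
      by exists (Some (inr (Ordinal em, t))); rewrite /= t2 /= t0 addn0.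
    have em : (e - m < m)%N by rewrite ltn_subLR // addnn mE.
    have [||t t2 t1] := @tnode_exists 2 2 1 => //.
    by exists (Some (inr (Ordinal em, t))); rewrite /= t2 /= t1 mul1n subnK.
  have [|e xe] := prim_rootP w_prim (_ : (x / u) ^+ q.-1 = 1).
    by rewrite exprMn exprVn xq uq invr1 mulr1.
  have xE : x = pt false e by rewrite /pt -xe mulrC divfK.
  have em : (e./2 < m)%N by rewrite ltn_half_double mE.
  rewrite {}xE -(odd_double_half e); case: (odd e).
    have [||t t1 t0] := @tnode_exists 1 1 0 => //.
    by exists (Some (inl (Ordinal em, t))).
  have [||t t1 t0] := @tnode_exists 2 1 0 => //.
  by exists (Some (inr (Ordinal em, t))); rewrite /= t1.
- case: a => -[i t] /=; first by rewrite (tparent1 _ (lvl1 t).1) /= f_di0.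
  case: eqVneq => [t1|t_neq1]; first by rewrite (tparent1 _ t1) /= f_di0.
  have [t2 _] := lvl2 t t_neq1; have [|t' [-> t1 _]] := tparentS t; first by rewrite t2.
  have w2 : (w ^+ (i + tindex t * m)) ^+ 2 = w ^+ i.*2.
    by rewrite -exprM mulnDl exprD -mulnA !muln2 mE exprM wq mulr1.
  by rewrite /= t1 t2 f_anti // /pt /= (exprMn 2 g) w2 mulrA.
- by rewrite f_di0 // /di expr0n gtn_eqF ?q_gt0 // subr0.
Qed.

End QuadraticMap.


Theorem theorem13 (K : finFieldType) (p k q s r : nat) (c : K) :
  prime p -> odd p -> (0 < k)%N -> q = (p ^ k)%N -> #|K| = (q ^ 2)%N ->
  q.-1 = (2 ^ s * r)%N -> odd r ->
  c != 0 -> c ^+ q = c ->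
  fg_iso (functional_graph (fun x : K => c * (x ^+ q.+1 - x ^+ 2)))
         (target_graph q s r).
Proof.
move=> p_prime odd_p k_gt0 qE cardK q1E odd_r c_neq0 c_frob.
have q_gt1 : (1 < q)%N by rewrite qE -(exp1n k) ltn_exp2r ?prime_gt1.
have odd_q : odd q by rewrite qE oddX odd_p orbT.
have frobD (x y : K) : (x + y) ^+ q = x ^+ q + y ^+ q.
  have pK : p \in [pchar K]%R by apply: card_finPcharP p_prime; rewrite cardK qE -expnM.
  by rewrite exprDn_pchar // qE pnatX (pnatE _ p_prime) pK.
have r_gt0 : (0 < r)%N by case: (r) odd_r.
pose Q d (x : K) := torus K q x && d.-primitive_root (mult K q c x ^+ (2 ^ s)).
apply: models_iso; apply: (@eq_models _ _
    (predU (fun x => ~~ torus K q x) (fun x => has (Q^~ x) (divisors r)))).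
  move=> x /=; have [xT|//] := boolP (torus K q x).
  (* Off the axes [mult x ^+ (2 ^ s)] is an [r]-th root of unity, so its order is one of the
     divisors of [r]. *)
  have [|d d_prim dr] := @prim_order_exists _ r (mult K q c x ^+ (2 ^ s)) r_gt0.
    by rewrite -exprM -q1E mult_unity.
  by apply/hasP; exists d; rewrite -?dvdn_divisors // /Q xT.
apply: models_sum; first by move=> x xT; apply/hasPn=> d _; rewrite /Q (negbTE xT).
  exact: models_axes.
apply: models_foldr_sum; first exact: divisors_uniq.
  by move=> d e x /andP[_ xd] /andP[_ xe]; apply: prim_root_unique xd xe.
by move=> d; rewrite -dvdn_divisors // => dr; apply: models_torus q1E odd_r dr.
Qed.
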